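(* Let $\mathcal T=[\mathbf A,\mathbf B,\mathbf C]_R$ with $\mathbf A\in\mathbb F^{I\times R}$, $\mathbf B\in\mathbb F^{J\times R}$, $\mathbf C\in\mathbb F^{K\times R}$, and let $$m_{\mathbf A}:=R-r_{\mathbf A}+2,\quad m_{\mathbf B}:=R-r_{\mathbf B}+2,\quad m_{\mathbf C}:=R-r_{\mathbf C}+2.$$ Suppose at least two of the matrices $$\mathcal C_{m_{\mathbf A}}(\mathbf B)\odot\mathcal C_{m_{\mathbf A}}(\mathbf C),\quad \mathcal C_{m_{\mathbf B}}(\mathbf C)\odot\mathcal C_{m_{\mathbf B}}(\mathbf A),\quad \mathcal C_{m_{\mathbf C}}(\mathbf A)\odot\mathcal C_{m_{\mathbf C}}(\mathbf B)$$ have full column rank. Then $r_{\mathcal T}=R$ and the CPD of $\mathcal T$ is unique.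
   Context: $\mathbb F$ is $\mathbb R$ or $\mathbb C$. For matrices $\mathbf A,\mathbf B,\mathbf C$ with $R$ nonzero columns each, $[\mathbf A,\mathbf B,\mathbf C]_R:=\sum_{r=1}^R\mathbf a_r\circ\mathbf b_r\circ\mathbf c_r$ ($\circ$ = outer product). The rank $r_{\mathcal T}$ of a tensor is the minimal number of terms in such a representation; a representation with $R=r_{\mathcal T}$ terms is a canonical polyadic decomposition (CPD). The CPD of a tensor $\mathcal T$ of rank $R$ is unique if $\mathcal T=[\mathbf A,\mathbf B,\mathbf C]_R=[\bar{\mathbf A},\bar{\mathbf B},\bar{\mathbf C}]_R$ implies that there are an $R\times R$ permutation matrix $\mathbf\Pi$ and nonsingular diagonal matrices $\mathbf\Lambda_{\mathbf A},\mathbf\Lambda_{\mathbf B},\mathbf\Lambda_{\mathbf C}$ with $\bar{\mathbf A}=\mathbf A\mathbf\Pi\mathbf\Lambda_{\mathbf A}$, $\bar{\mathbf B}=\mathbf B\mathbf\Pi\mathbf\Lambda_{\mathbf B}$, $\bar{\mathbf C}=\mathbf C\mathbf\Pi\mathbf\Lambda_{\mathbf C}$, $\mathbf\Lambda_{\mathbf A}\mathbf\Lambda_{\mathbf B}\mathbf\Lambda_{\mathbf C}=\mathbf I_R$. $r_{\mathbf M}$ is the rank of a matrix $\mathbf M$. $\odot$ is the Khatri-Rao (column-wise Kronecker) product. For $\mathbf M\in\mathbb F^{p\times R}$ the $k$-th compound matrix $\mathcal C_k(\mathbf M)$ is the $\binom pk\times\binom Rk$ matrix of all $k\times k$ minors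 of $\mathbf M$, with row and column index sets ordered lexicographically; it is defined for $k\le\min(p,R)$, and a hypothesis that a Khatri-Rao product of compound matrices has full column rank is understood to include that these compound matrices are defined. *)

(* Defs.v *)
From mathcomp Require Import all_boot all_order all_algebra.
From mathcomp Require Import reals.
From mathcomp Require Export complex mxtens.

Set Implicit Arguments.
Unset Strict Implicit.
Unset Printing Implicit Defensive.

Import Order.TTheory GRing.Theory Num.Theory.
Local Open Scope ring_scope.

Section Compound.

Lemma card_ksubs p k :
  #|[set t : k.-tuplelexi 'I_p | sorted ltn [seq val i | i <- t]]| = 'C(p, k).
Proof. exact: card_ltn_sorted_tuples. Qed.

(* A k-subset of 'I_p is encoded as the increasing k-tuple of its elements;    *)
(* ksub i is the i-th such tuple in lexicographic order (Order.enum_val        *)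
(* enumerates increasingly for the order of k.-tuplelexi 'I_p).                *)
Definition ksub p k (i : 'I_('C(p, k))) : k.-tuple 'I_p :=
  Order.enum_val (cast_ord (esym (card_ksubs p k)) i).

(* When k > minn p q this is an empty matrix; uses of compound_mx that require *)
(* it to be defined must state k <= minn p q separately.                       *)
Definition compound_mx (F : fieldType) p q (k : nat) (M : 'M[F]_(p, q)) :
    'M[F]_('C(p, k), 'C(q, k)) :=
  \matrix_(i, j) \det (mxsub (tnth (ksub i)) (tnth (ksub j)) M).

End Compound.

Section KhatriRao.
Variable F : fieldType.

Definition khatri_rao p q n (A : 'M[F]_(p, n)) (B : 'M[F]_(q, n)) :
    'M[F]_(p * q, n) :=
  \matrix_(i, r) (col r A *t col r B) i ord0.

Definition compound_kr_full_col_rank p q n (k : nat)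
    (A : 'M[F]_(p, n)) (B : 'M[F]_(q, n)) : Prop :=
  [/\ (k <= minn p n)%N, (k <= minn q n)%N &
      row_full (khatri_rao (compound_mx k A) (compound_mx k B))].

End KhatriRao.

Section Tensor.
Variables (F : fieldType) (I J K : nat).

Definition tensor := {ffun 'I_I * 'I_J * 'I_K -> F}.

Definition outer (a : 'cV[F]_I) (b : 'cV[F]_J) (c : 'cV[F]_K) : tensor :=
  [ffun ijk => a ijk.1.1 0 * b ijk.1.2 0 * c ijk.2 0].

Definition nonzero_cols p n (M : 'M[F]_(p, n)) : Prop :=
  forall r, col r M != 0.

Definition polyadic (T : tensor) R
    (A : 'M[F]_(I, R)) (B : 'M[F]_(J, R)) (C : 'M[F]_(K, R)) : Prop :=
  [/\ nonzero_cols A, nonzero_cols B, nonzero_cols C &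
      T = \sum_(r < R) outer (col r A) (col r B) (col r C)].

Definition has_polyadic (T : tensor) (R : nat) : Prop :=
  exists A : 'M[F]_(I, R), exists B : 'M[F]_(J, R), exists C : 'M[F]_(K, R),
    polyadic T A B C.

Definition is_tensor_rank (T : tensor) (R : nat) : Prop :=
  has_polyadic T R /\ (forall n, has_polyadic T n -> (R <= n)%N).

(* Meant for T of rank R, in which case the R-term decompositions of T are its *)
(* CPDs.                                                                       *)
Definition cpd_unique (T : tensor) (R : nat) : Prop :=
  forall (A A' : 'M[F]_(I, R)) (B B' : 'M[F]_(J, R)) (C C' : 'M[F]_(K, R)),
    polyadic T A B C -> polyadic T A' B' C' ->
  exists P LA LB LC : 'M[F]_R,
    [/\ is_perm_mx P,
        [/\ is_diag_mx LA, is_diag_mx LB & is_diag_mx LC],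
        [/\ LA \in unitmx, LB \in unitmx & LC \in unitmx],
        [/\ A' = A *m P *m LA, B' = B *m P *m LB & C' = C *m P *m LC] &
        LA *m LB *m LC = 1%:M].

End Tensor.

(* Main.v *)
(* By Cauchy-Binet, full column rank of C_m(B) (.) C_m(C) gives: for k < m,    *)
(* rank (B diag(d) C^T) <= k forces d to have at most k nonzero entries.       *)
(* Contracting two decompositions of T with z in the first mode gives          *)
(* B diag(A^T z) C^T = B' diag(A'^T z) C'^T, so A^T z has at most as many      *)
(* nonzero entries as A'^T z whenever the latter has few; Kruskal's            *)
(* permutation lemma then yields R <= R', and, if R' = R, that the columns of  *)
(* A' are those of A up to a permutation s and scaling.  The second condition  *)
(* does the same for B with a permutation t.  To see that s = t, take z with   *)
(* S = supp (A^T z) of size < m_A.  Both sides above have rank #|S|, so        *)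
(* {b_i | i in S} and {b_(t i) | s i in S} have the same span; as any m_A      *)
(* columns of B are independent, t and s agree on S as sets.  Such sets S      *)
(* separate indices because no two columns of A are proportional.  Finally     *)
(* A (.) B has full column rank, which determines C'.  The argument works over *)
(* any field.                                                                  *)

Require Import Defs.
From mathcomp Require Import all_boot all_order all_algebra.
From mathcomp Require Import reals.
From mathcomp Require Import all_fingroup zify ring.
Set Implicit Arguments.
Unset Strict Implicit.
Unset Printing Implicit Defensive.
Import GRing.Theory.
Local Open Scope ring_scope.

(** * The Cauchy-Binet formula *)

(** The link between minors and Kruskal's argument is [slice B C (A^T *m z)], which depends only on
    the tensor and z ([same_tensor_slice]). A competing decomposition bounds its rank by the number
    of nonzero entries of [A'^T *m z]; in the given one, a small rank bounds the number of nonzero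
    entries of [A^T *m z] ([compound_kr_supp_le_rank]). Hence a z orthogonal to enough columns of A'
    misses at most as many columns of A as of A'.

    [outside_le] extends this comparison from hyperplanes to all spans of columns of A'. The zero
    span gives the minimality of R ([supp_le_leq]), the lines give a permutation
    ([permutation_lemma]). [same_perm] identifies the permutations found in two modes, and
    [slice_eq0] then determines the third factor. *)

Section CauchyBinet.
Variables n k : nat.

Lemma ksub_sorted (s : 'I_('C(n, k))) : sorted ltn [seq val i | i <- ksub s].
Proof. by have := Order.enum_valP (cast_ord (esym (card_ksubs n k)) s); rewrite inE. Qed.

Lemma tnth_ksub_inj (s : 'I_('C(n, k))) : injective (tnth (ksub s)).
Proof.
apply/injectiveP; rewrite /injectiveb /dinjectiveb map_tnth_enum.
rewrite -(map_inj_uniq val_inj).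
exact: (sorted_uniq ltn_trans ltnn (ksub_sorted s)).
Qed.

(** Every injection of 'I_k into 'I_n is, in exactly one way, a permutation followed by the
    increasing enumeration of a k-subset; surjectivity follows by counting. *)
Definition ksub_ffun (p : 'I_('C(n, k)) * 'S_k) : {ffun 'I_k -> 'I_n} :=
  [ffun i => tnth (ksub p.1) (p.2 i)].

Lemma ksub_ffun_inj : injective ksub_ffun.
Proof.
move=> [s t] [s' t'] eq_st.
have eqf i : tnth (ksub s) (t i) = tnth (ksub s') (t' i).
  by have /ffunP/(_ i) := eq_st; rewrite !ffunE.
have eqs : s = s'.
  apply: (@cast_ord_inj _ _ (esym (card_ksubs n k))); apply: Order.enum_val_inj.
  apply: val_inj => /=.
  apply: (inj_map val_inj); apply: (irr_sorted_eq ltn_trans ltnn);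
    rewrite ?ksub_sorted // => x.
  apply/mapP/mapP => -[y /tnthP[i ->] ->].
    by exists (tnth (ksub s') (t' (t^-1%g i))); rewrite ?mem_tnth // -eqf permKV.
  by exists (tnth (ksub s) (t (t'^-1%g i))); rewrite ?mem_tnth // eqf permKV.
subst s'; congr (_, _); apply/permP => i.
exact: tnth_ksub_inj (eqf i).
Qed.

Lemma ksub_ffun_onto : ksub_ffun @: setT = [set f : {ffun 'I_k -> 'I_n} | injectiveb f].
Proof.
apply/eqP; rewrite eqEcard; apply/andP; split.
  apply/subsetP => _ /imsetP[[s t] _ ->]; rewrite inE; apply/injectiveP => i j.
  by rewrite !ffunE => /tnth_ksub_inj/perm_inj.
rewrite card_inj_ffuns (card_imset _ ksub_ffun_inj) cardsT card_prod card_Sn.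
by rewrite !card_ord bin_ffact.
Qed.

(** Expand the product over all maps f from 'I_k to 'I_n. Non-injective f repeat a row of Y and
    contribute 0; the injective ones are grouped by image, and each group sums to one product of
    minors. *)
Theorem det_mulmx_compound (F : comNzRingType) (X : 'M[F]_(k, n)) (Y : 'M_(n, k)) :
  \det (X *m Y) = \sum_s \det (colsub (tnth (ksub s)) X) *
                         \det (rowsub (tnth (ksub s)) Y).
Proof.
pose g (f : {ffun 'I_k -> 'I_n}) := (\prod_i X i (f i)) * \det (rowsub f Y).
transitivity (\sum_f g f).
  rewrite /determinant.
  under eq_bigr => s _.
    under eq_bigr => i _ do rewrite mxE.
    rewrite bigA_distr_bigA /= big_distrr /=.
  over.
  rewrite exchange_big; apply: eq_bigr => f _ /=.
  rewrite /g big_distrr /=; apply: eq_bigr => s _.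
  rewrite big_split mulrCA; congr (_ * (_ * _)).
  by apply: eq_bigr => i _; rewrite mxE.
rewrite (bigID (fun f : {ffun _} => injectiveb f)) /= [X in _ + X]big1 ?addr0; last first.
  move=> f /injectivePn[i1 [i2 Di12 Ef12]]; rewrite /g (determinant_alternate Di12) ?mulr0 //.
  by move=> j; rewrite !mxE Ef12.
under eq_bigl => f do rewrite -(in_set (fun f : {ffun _} => injectiveb f)).
rewrite -ksub_ffun_onto (big_imset _ (in2W ksub_ffun_inj)) /=.
under eq_bigl => f do rewrite inE.
rewrite -(pair_bigA _ (fun s t => g (ksub_ffun (s, t)))) /=; apply: eq_bigr => s _.
rewrite /determinant big_distrl /=; apply: eq_bigr => t _.
rewrite /g.
have -> : rowsub (ksub_ffun (s, t)) Y = row_perm t (rowsub (tnth (ksub s)) Y).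
  by apply/matrixP => i j; rewrite !mxE ffunE.
rewrite row_permE det_mulmx det_perm mulrA [X in X * _ = _]mulrC.
congr (_ * _ * _).
by apply: eq_bigr => i _; rewrite !mxE ffunE.
Qed.

Lemma ksub_in (S : {set 'I_n}) : (k <= #|S|)%N ->
  exists s : 'I_('C(n, k)), forall i, tnth (ksub s) i \in S.
Proof.
move=> leS; pose f := [ffun i : 'I_k => enum_val (widen_ord leS i)].
have : f \in ksub_ffun @: setT.
  rewrite ksub_ffun_onto inE; apply/injectiveP => i j.
  by rewrite !ffunE => /enum_val_inj/(congr1 val)/= /val_inj.
case/imsetP => -[s t] _ eqf; exists s => i.
have := congr1 (fun h : {ffun _ -> _} => h (t^-1%g i)) eqf.
by rewrite !ffunE permKV /= => <-; apply: enum_valP.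
Qed.

End CauchyBinet.

(** * Matrix slices of small rank *)

Section Support.
Variable F : fieldType.

Definition supp n (d : 'cV[F]_n) : {set 'I_n} := [set i | d i 0 != 0].

Definition rowspan n p (N : 'M[F]_(n, p)) (X : {set 'I_n}) : 'M[F]_p :=
  (\sum_(i in X) <<row i N>>)%MS.

Lemma row_rowspan n p (N : 'M[F]_(n, p)) (X : {set 'I_n}) i :
  i \in X -> (row i N <= rowspan N X)%MS.
Proof. by move=> iX; apply: (sumsmx_sup i) => //; rewrite genmxE. Qed.

Lemma rowspan_sub n p q (N : 'M[F]_(n, p)) (X : {set 'I_n}) (V : 'M_(q, p)) :
  (forall i, i \in X -> (row i N <= V)%MS) -> (rowspan N X <= V)%MS.
Proof. by move=> sNV; apply/sumsmx_subP => i iX; rewrite genmxE sNV. Qed.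

Lemma rank_rowspan n p (N : 'M[F]_(n, p)) (X : {set 'I_n}) : (\rank (rowspan N X) <= #|X|)%N.
Proof.
rewrite -sum1_card /rowspan; elim/big_ind2: _ => [|A a B b leA leB|i _].
- by rewrite mxrank0.
- by rewrite (leq_trans (mxrank_adds_leqif A B)) // leq_add.
- by rewrite genmxE rank_leq_row.
Qed.

Lemma diag_mx_sub_rowspan n p (d : 'cV[F]_n) (N : 'M_(n, p)) :
  (diag_mx d^T *m N <= rowspan N (supp d))%MS.
Proof.
apply/row_subP => i; rewrite row_mul row_diag_mx -scalemxAl -rowE mxE.
have [->|di0] := eqVneq (d i 0) 0; first by rewrite scale0r sub0mx.
by rewrite scalemx_sub // row_rowspan // inE.
Qed.

(** With [d = C^T *m z] this is the contraction of [A,B,C] with z in the third mode. *)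
Definition slice p q n (A : 'M[F]_(p, n)) (B : 'M[F]_(q, n)) (d : 'cV_n) : 'M[F]_(p, q) :=
  A *m diag_mx d^T *m B^T.

Lemma tr_slice p q n (A : 'M[F]_(p, n)) (B : 'M[F]_(q, n)) d :
  (slice A B d)^T = slice B A d.
Proof. by rewrite /slice !trmx_mul trmxK tr_diag_mx mulmxA. Qed.

Lemma sliceE p q n (A : 'M[F]_(p, n)) (B : 'M[F]_(q, n)) d i j :
  slice A B d i j = \sum_r A i r * d r 0 * B j r.
Proof. by rewrite /slice mul_mx_diag mxE; apply: eq_bigr => r _; rewrite !mxE. Qed.

Lemma rank_slice p q n (A : 'M[F]_(p, n)) (B : 'M[F]_(q, n)) d :
  (\rank (slice A B d) <= #|supp d|)%N.
Proof.
rewrite /slice -mulmxA (leq_trans (mxrankM_maxr _ _)) //.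
exact: leq_trans (mxrankS (diag_mx_sub_rowspan _ _)) (rank_rowspan _ _).
Qed.

Definition supp_le_rank p q n (m : nat) (A : 'M[F]_(p, n)) (B : 'M[F]_(q, n)) : Prop :=
  forall k d, (k < m)%N -> (\rank (slice A B d) <= k)%N -> (#|supp d| <= k)%N.

Lemma supp_le_rank_sym p q n m (A : 'M[F]_(p, n)) (B : 'M[F]_(q, n)) :
  supp_le_rank m A B -> supp_le_rank m B A.
Proof. by move=> AB k d km; rewrite -tr_slice mxrank_tr; apply: AB. Qed.

Lemma det_mxsub_slice p q n m (A : 'M[F]_(p, n)) (B : 'M[F]_(q, n)) d
    (f : 'I_m -> 'I_p) (g : 'I_m -> 'I_q) :
  \det (mxsub f g (slice A B d)) =
  \sum_s \det (mxsub f (tnth (ksub s)) A) * \det (mxsub g (tnth (ksub s)) B) *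
         \prod_i d (tnth (ksub s) i) 0.
Proof.
rewrite /slice mxsub_mul det_mulmx_compound; apply: eq_bigr => s _.
set h := tnth (ksub s).
have -> : colsub h (rowsub f (A *m diag_mx d^T)) =
          mxsub f h A *m diag_mx (\row_i d (h i) 0).
  by rewrite !mul_mx_diag; apply/matrixP => i j; rewrite !mxE.
have -> : rowsub h (colsub g B^T) = (mxsub g h B)^T by apply/matrixP => i j; rewrite !mxE.
rewrite det_mulmx det_tr det_diag mulrAC; congr (_ * _).
by apply: eq_bigr => i _; rewrite mxE.
Qed.

Lemma det_eq0_rank n (A : 'M[F]_n) : (\rank A < n)%N -> \det A = 0.
Proof.
move=> rA; apply/eqP; apply: contraTT rA => dA; rewrite -leqNgt mxrank_unit //.
by rewrite unitmxE unitfE.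
Qed.

Lemma rank_mxsub p q p' q' (f : 'I_p' -> 'I_p) (g : 'I_q' -> 'I_q) (A : 'M[F]_(p, q)) :
  (\rank (mxsub f g A) <= \rank A)%N.
Proof.
rewrite -[A in X in (X <= _)%N](mulmx1 A) mxsub_mul.
by rewrite (leq_trans (mxrankM_maxl _ _)) // rowsubE mxrankM_maxr.
Qed.

(** All minors of order m of the slice vanish. By Cauchy-Binet they are the entries of the
    Khatri-Rao product applied to the vector [v] of m-fold products of entries of d, so [v = 0] and
    no m entries of d are all nonzero. *)
Lemma compound_kr_supp p q n m (A : 'M[F]_(p, n)) (B : 'M[F]_(q, n)) d :
  compound_kr_full_col_rank m A B ->
  (\rank (slice A B d) < m)%N -> (#|supp d| < m)%N.
Proof.
case=> _ _ fullAB rk; rewrite ltnNge; apply/negP => /ksub_in[s0 s0d].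
pose v : 'cV[F]_('C(n, m)) := \col_s \prod_i d (tnth (ksub s) i) 0.
have v0 : v = 0.
  apply: (row_full_inj fullAB); rewrite mulmx0; apply/matrixP => i j; rewrite !mxE.
  pose f := tnth (ksub (mxtens_unindex i).1); pose g := tnth (ksub (mxtens_unindex i).2).
  have := det_mxsub_slice A B d f g.
  rewrite det_eq0_rank ?(leq_ltn_trans (rank_mxsub _ _ _)) // => {2}->.
  by apply: eq_bigr => s _; rewrite /tensmx !mxE.
have /eqP := congr1 (fun w : 'cV_ _ => w s0 0) v0; rewrite !mxE => /prodf_eq0[i _].
by apply/negP; have := s0d i; rewrite inE.
Qed.

Lemma compound_kr_supp_le_rank p q n m (A : 'M[F]_(p, n)) (B : 'M[F]_(q, n)) :
  compound_kr_full_col_rank m A B -> supp_le_rank m A B.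
Proof.
move=> krAB k d km; have mn : (m <= n)%N by case: krAB; rewrite leq_min => /andP[].
have {km} [j km] : exists j, (j + k).+1 = m by exists (m - k.+1)%N; rewrite -addnS subnK.
(* If #|supp d| = k.+1, one more nonzero entry would violate the bound for k.+1. *)
elim: j k d km => [|j IH] k d km rk.
  by have := compound_kr_supp krAB (d := d); rewrite -km; apply.
have skd : (#|supp d| <= k.+1)%N.
  by apply: IH; rewrite ?addnS -?addSn // (leq_trans rk).
rewrite leqNgt; apply/negP => kd.
have {skd kd} sd : #|supp d| = k.+1 by apply/eqP; rewrite eqn_leq skd.
(* Here [m <= n], part of the compound matrices being defined, leaves an index free, since
   [k.+1 < m]. *)
have [i di] : exists i, i \notin supp d.
  have : (#|~: supp d| > 0)%N.
    by rewrite cardsCs setCK card_ord sd subn_gt0 (leq_trans _ mn) // -km addSn !ltnS leq_addl.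
  by case/card_gt0P => i; rewrite inE; exists i.
have di0 : d i 0 = 0 by move: di; rewrite inE negbK => /eqP.
have suppe : supp (delta_mx i 0) = [set i].
  by apply/setP => r; rewrite !inE mxE eqxx andbT; case: (r == i); rewrite ?oner_eq0 ?eqxx.
have suppD : supp (d + delta_mx i 0) = i |: supp d.
  apply/setP => r; rewrite !inE !mxE eqxx andbT.
  by have [->|] := eqVneq r i; rewrite ?addr0 // di0 add0r oner_eq0.
have : (#|supp (d + delta_mx i (0 : 'I_1))%R| <= k.+1)%N.
  apply: IH; rewrite ?addnS -?addSn //.
  have -> : slice A B (d + delta_mx i 0) = slice A B d + slice A B (delta_mx i 0).
    apply/matrixP => r c; rewrite [RHS]mxE !sliceE -big_split; apply: eq_bigr => t _ /=.
    by rewrite mxE mulrDr mulrDl.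
  rewrite (leq_trans (mxrank_add _ _)) // -[k.+1]addn1 leq_add //.
  by rewrite (leq_trans (rank_slice _ _ _)) // suppe cards1.
by rewrite suppD cardsU1 di sd ltnn.
Qed.

(** Any m columns of A are independent: a relation y makes one column redundant, so the slice at y
    has rank below the number of nonzero entries of y. *)
Lemma supp_le_rank_free p q n m (A : 'M[F]_(p, n)) (B : 'M[F]_(q, n)) (y : 'cV_n) :
  supp_le_rank m A B -> A *m y = 0 -> (#|supp y| <= m)%N -> y = 0.
Proof.
move=> AB Ay ym; have [y0|[r ry]] := set_0Vmem (supp y).
  apply/colP => i; apply/eqP; have /setP/(_ i) := y0.
  by rewrite !inE mxE => /negbT; rewrite negbK.
have yr0 : y r 0 != 0 by move: ry; rewrite inE.
have eq1 : (#|supp y| = (#|supp y :\ r|).+1)%N by rewrite (cardsD1 r) ry.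
have : (#|supp y| <= #|supp y :\ r|)%N.
  apply: AB; first by rewrite -eq1.
  rewrite -tr_slice mxrank_tr (leq_trans _ (rank_rowspan A^T _)) // /slice -mulmxA.
  rewrite (leq_trans (mxrankM_maxr _ _)) // mxrankS //.
  apply: submx_trans (diag_mx_sub_rowspan _ _) _; apply: rowspan_sub => i iy.
  have [->|ir] := eqVneq i r; last by rewrite row_rowspan // !inE ir; move: iy; rewrite inE.
  have : y^T *m A^T = 0 by rewrite -trmx_mul Ay trmx0.
  rewrite mulmx_sum_row (bigD1 r) //= mxE => /eqP; rewrite addr_eq0 => /eqP eqr.
  rewrite -[row r _](scalerK yr0) eqr scalemx_sub // eqmx_opp summx_sub // => s sr.
  rewrite mxE; have [->|ys0] := eqVneq (y s 0) 0; first by rewrite scale0r sub0mx.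
  by rewrite scalemx_sub // row_rowspan // !inE sr.
by rewrite eq1 ltnn.
Qed.

End Support.

(** * Vectors separating a row from a span of rows *)

Section Hyperplanes.
Variable F : fieldType.

Lemma supp_mulmx n K (M : 'M[F]_(n, K)) (z : 'cV_K) i :
  (i \in supp (M *m z)) = (row i M *m z != 0).
Proof.
rewrite inE -row_mul; congr (~~ _); apply/eqP/eqP => [z0|/rowP/(_ 0)]; last by rewrite !mxE.
by apply/rowP => j; rewrite ord1 mxE z0 mxE.
Qed.

Lemma sub_rV_sym K (v w : 'rV[F]_K) : v != 0 -> (v <= w)%MS -> (w <= v)%MS.
Proof.
move=> v0 /sub_rVP[a va]; apply/sub_rVP; exists a^-1; rewrite va scalerK //.
by apply: contraNneq v0 => a0; rewrite va a0 scale0r.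
Qed.

Lemma separating_vector p K (U : 'M[F]_(p, K)) (v : 'rV_K) :
  ~~ (v <= U)%MS -> exists2 z : 'cV_K, U *m z = 0 & v *m z != 0.
Proof.
rewrite submxE => /rowV0Pn[w /submxP[a wE] w0].
have [i vi0] : exists i, (v *m cokermx U) 0 i != 0.
  apply/existsP; apply: contraNT w0; rewrite negb_exists => /forallP all0.
  rewrite wE; apply/eqP; suff -> : v *m cokermx U = 0 by rewrite mulmx0.
  by apply/rowP => i; have /negPn/eqP -> := all0 i; rewrite mxE.
exists (col i (cokermx U)); first by rewrite colE mulmxA mulmx_coker mul0mx.
apply: contraNneq vi0 => vz; have /matrixP/(_ 0 0) := vz.
by rewrite colE mulmxA -colE mxE [in RHS]mxE => ->.
Qed.

Lemma addsmx_exchange p K (U : 'M[F]_(p, K)) (v w : 'rV_K) :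
  (w <= U + v)%MS -> ~~ (w <= U)%MS -> (v <= U + w)%MS.
Proof.
case/sub_addsmxP => -[a b] /= wE wU.
have b0 : b 0 0 != 0.
  apply: contraNneq wU => b0.
  by rewrite wE [b]mx11_scalar b0 mul_scalar_mx scale0r addr0 submxMl.
have -> : v = (b 0 0)^-1 *: (- a *m U + w).
  by rewrite wE mulNmx addKr {2}[b]mx11_scalar mul_scalar_mx scalerK.
by rewrite scalemx_sub // addmx_sub_adds // submxMl.
Qed.

Lemma hyperplane_mem p K (U : 'M[F]_(p, K)) (v w : 'rV_K) (z : 'cV_K) :
  U *m z = 0 -> v *m z != 0 -> (w <= U + v)%MS -> (w *m z == 0) = (w <= U)%MS.
Proof.
move=> Uz vz wUv; apply/eqP/idP => [wz|/submxP[a ->]]; last by rewrite -mulmxA Uz mulmx0.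
apply: contraNT vz => wU; have /sub_addsmxP[u ->] := addsmx_exchange wUv wU.
by rewrite mulmxDl -!mulmxA Uz wz !mulmx0 addr0.
Qed.

Lemma sub_of_kernel n p K (M : 'M[F]_(n, K)) (N : 'M_(p, K)) :
  (forall z : 'cV_K, N *m z = 0 -> M *m z = 0) -> (M <= N)%MS.
Proof.
move=> ker; apply/row_subP => i; apply: contraT => /separating_vector[z /ker Mz].
by rewrite -row_mul Mz raddf0 eqxx.
Qed.

(* z vanishes on a maximal set of rows whose span omits v; by exchange, that    *)
(* span has codimension at most 1 in the row space.                             *)
Lemma separating_vector_small_supp n K (M : 'M[F]_(n, K)) (X : {set 'I_n}) (v : 'rV_K) :
  ~~ (v <= rowspan M X)%MS ->
  exists z : 'cV_K, [/\ forall i, i \in X -> row i M *m z = 0, v *m z != 0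
    & (#|supp (M *m z)| + \rank M <= n.+1)%N].
Proof.
move=> vX; have [Y /maxsetP[vY maxY] XY] :=
  maxset_exists (P := fun Y => ~~ (v <= rowspan M Y)%MS) vX.
have [z Yz vz] := separating_vector vY.
have z0 i : i \in Y -> row i M *m z = 0.
  by move=> /(row_rowspan M)/submxP[a ->]; rewrite -mulmxA Yz mulmx0.
exists z; split=> // [i iX|]; first by rewrite z0 // (subsetP XY).
have rM : (\rank M <= #|Y|.+1)%N.
  have /mxrankS/leq_trans : (M <= rowspan M Y + v)%MS.
    apply/row_subP => i; have [iY|iY] := boolP (i \in Y).
      exact: submx_trans (row_rowspan M iY) (addsmxSl _ _).
    apply: (addsmx_exchange _ vY); apply: contraT => vi.
    have {vi} viY : ~~ (v <= rowspan M (i |: Y))%MS.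
      apply: contra vi => /submx_trans; apply; apply: rowspan_sub => k.
      rewrite !inE => /predU1P[->|kY]; first exact: addsmxSr.
      exact: submx_trans (row_rowspan M kY) (addsmxSl _ _).
    by move: iY; rewrite -[in X in X -> _](maxY _ viY) ?subsetUr // setU11.
  apply; rewrite (leq_trans (mxrank_adds_leqif _ _)) // -[#|Y|.+1]addn1.
  by rewrite leq_add ?rank_rowspan ?rank_leq_row.
have : (#|supp (M *m z)| <= #|~: Y|)%N.
  apply/subset_leq_card/subsetP => i; rewrite supp_mulmx inE.
  by apply: contra => /z0 ->.
by have := cardsC Y; rewrite card_ord; lia.
Qed.

End Hyperplanes.

(** * Kruskal's permutation lemma *)

Section PermutationLemma.
Variables (F : fieldType) (K : nat).

Definition outside n p (M : 'M[F]_(n, K)) (U : 'M_(p, K)) : {set 'I_n} :=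
  [set i | ~~ (row i M <= U)%MS].

(** Double counting of the pairs (Y, k) with Y in P and row k outside U, split by whether row k lies
    in [V Y]. *)
Lemma sum_outside n p (M : 'M[F]_(n, K)) (U : 'M_(p, K)) (I : finType) (P : {set I})
    (V : I -> 'M_K) :
  (forall Y, Y \in P -> (U <= V Y)%MS) ->
  (#|P| * #|outside M U| = \sum_(Y in P) #|outside M (V Y)| +
     \sum_(k in outside M U) #|[set Y in P | row k M <= V Y]%MS|)%N.
Proof.
move=> UV; under [X in (_ + X)%N]eq_bigr => k _.
  rewrite -sum1_card; under eq_bigl => Y do rewrite inE.
  rewrite big_mkcondr.
over.
rewrite exchange_big -big_split -sum_nat_const; apply: eq_bigr => Y YP /=.
rewrite -big_mkcondr /= sum1dep_card addnC.
rewrite -[LHS](cardsID [set k | (row k M <= V Y)%MS]).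
congr (_ + _)%N; apply: eq_card => k; rewrite !inE //.
apply: andb_idr => kV; apply: contra kV => /submx_trans; apply; exact: UV.
Qed.

Variables (n n' : nat) (M : 'M[F]_(n, K)) (M' : 'M[F]_(n', K)).
Hypothesis supp_le : forall z : 'cV_K,
  (#|supp (M' *m z)| + \rank M' <= n'.+1)%N -> (#|supp (M *m z)| <= #|supp (M' *m z)|)%N.

Lemma supp_le_sub : (M <= M')%MS.
Proof.
apply: sub_of_kernel => z M'z; have s0 : supp (M' *m z) = set0.
  by apply/setP => i; rewrite M'z !inE mxE eqxx.
have := @supp_le z; rewrite s0 cards0 add0n (leq_trans (rank_leq_row _)) // => /(_ isT).
rewrite leqn0 cards_eq0 => /eqP/setP Mz; apply/colP => i.
by have := Mz i; rewrite !inE => /negbFE/eqP ->; rewrite mxE.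
Qed.

(* Induction from larger to smaller flats U of the rows of M'.  If U is a       *)
(* hyperplane, supp_le applies to a z vanishing on U.  Otherwise at least two   *)
(* flats U + row i M' lie directly above U; they partition the rows of M'       *)
(* outside U, are disjoint on the rows of M outside U, and satisfy the claim.   *)
Lemma outside_le (X : {set 'I_n'}) :
  (#|outside M (rowspan M' X)| <= #|outside M' (rowspan M' X)|)%N.
Proof.
have [k] := ubnP #|outside M' (rowspan M' X)|; elim: k X => // k IH X; set U := rowspan M' X.
rewrite ltnS => leXk; have [E'0|[j jE']] := set_0Vmem (outside M' U).
  have M'U : (M' <= U)%MS.
    by apply/row_subP => i; have /setP/(_ i) := E'0; rewrite !inE => /negbFE.
  rewrite E'0 cards0 leqn0 cards_eq0; apply/eqP/setP => i; rewrite !inE.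
  apply/negbF; exact: submx_trans (row_sub i M) (submx_trans supp_le_sub M'U).
pose V i := (U + row i M')%MS.
have UV i : (U <= V i)%MS by apply: addsmxSl.
have [M'V|] := boolP (M' <= V j)%MS.
  have jU : ~~ (row j M' <= U)%MS by move: jE'; rewrite inE.
  have [z Uz jz] := separating_vector jU.
  have outE m (N : 'M_(m, K)) : (N <= V j)%MS -> outside N U = supp (N *m z).
    move=> NV; apply/setP => i; rewrite supp_mulmx inE; congr (~~ _); apply/esym.
    exact: hyperplane_mem Uz jz (submx_trans (row_sub i N) NV).
  rewrite !outE ?(submx_trans supp_le_sub) // supp_le // -outE //.
  (* The size condition of [supp_le]: U has codimension at most 1 in the row space of M', and its
     rank is at most the number of rows of M' in it. *)
  have rM' : (\rank M' <= (\rank U).+1)%N.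
    rewrite (leq_trans (mxrankS M'V)) // (leq_trans (mxrank_adds_leqif _ _)) //.
    by rewrite -[(\rank U).+1]addn1 leq_add // rank_leq_row.
  have rU : (\rank U <= #|~: outside M' U|)%N.
    rewrite (leq_trans (rank_rowspan _ _)) // subset_leq_card //; apply/subsetP => i iX.
    by rewrite !inE negbK row_rowspan.
  by have := cardsC (outside M' U); rewrite card_ord; lia.
case/row_subPn => j0 j0V.
(* A flat is recorded by all the rows of M' it contains, so that equal flats count once in P. *)
pose phi i := [set l | (row l M' <= V i)%MS].
have phiV i : (rowspan M' (phi i) :=: V i)%MS.
  apply/eqmxP; rewrite rowspan_sub /= => [|l]; last by rewrite inE.
  rewrite addsmx_sub row_rowspan ?inE ?addsmxSr // andbT; apply: rowspan_sub => l lX.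
  by rewrite row_rowspan // inE (submx_trans (row_rowspan M' lX)).
pose P := phi @: outside M' U.
have uniqP (v : 'rV_K) : ~~ (v <= U)%MS -> (#|[set Y in P | v <= rowspan M' Y]%MS| <= 1)%N.
  move=> vU; apply/card_le1_eqP => Y Z; rewrite !inE.
  case/andP => /imsetP[i iE' ->]; rewrite phiV => vi.
  case/andP => /imsetP[l lE' ->]; rewrite phiV => vl.
  have sub a b : (v <= V a)%MS -> (v <= V b)%MS -> (V a <= V b)%MS.
    move=> va vb; have := addsmx_exchange va vU; rewrite addsmx_sub UV => /submx_trans; apply.
    by rewrite addsmx_sub UV vb.
  have eqV : (V i :=: V l)%MS by apply/eqmxP; rewrite !sub.
  by apply/setP => r; rewrite !inE eqV.
have USpan Y : Y \in P -> (U <= rowspan M' Y)%MS by case/imsetP => i _ ->; rewrite phiV.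
have leP Y : Y \in P -> (#|outside M (rowspan M' Y)| <= #|outside M' (rowspan M' Y)|)%N.
  move=> YP; apply: IH; apply: leq_trans leXk; apply: proper_card.
  rewrite properE; apply/andP; split.
    by apply/subsetP => i; rewrite !inE; apply: contra => /submx_trans; apply; apply: USpan.
  apply/subsetPn; case/imsetP: YP => i iE' ->; exists i => //.
  by rewrite inE negbK phiV addsmxSr.
have sumE := sum_outside M USpan; have sumE' := sum_outside M' USpan.
have le1 : (\sum_(r in outside M U) #|[set Y in P | row r M <= rowspan M' Y]%MS|
            <= #|outside M U|)%N.
  by rewrite -sum1_card leq_sum // => r; rewrite inE => /uniqP.
have ge1 : (\sum_(r in outside M' U) #|[set Y in P | row r M' <= rowspan M' Y]%MS|
            = #|outside M' U|)%N.
  rewrite -sum1_card; apply: eq_bigr => r rE'; apply/eqP; rewrite eqn_leq.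
  rewrite uniqP; last by move: rE'; rewrite inE.
  apply/card_gt0P; exists (phi r).
  by rewrite inE imset_f //= phiV addsmxSr.
have leS : (\sum_(Y in P) #|outside M (rowspan M' Y)|
            <= \sum_(Y in P) #|outside M' (rowspan M' Y)|)%N by apply: leq_sum.
have P2 : (1 < #|P|)%N.
  have j0E' : j0 \in outside M' U.
    by rewrite inE; apply: contra j0V => /submx_trans; apply.
  apply/card_gt1P; exists (phi j), (phi j0); rewrite !imset_f //; split=> //.
  apply: contraNneq j0V => /setP/(_ j0); rewrite !inE addsmxSr; by [].
(* With p = [#|P|], e and e' the numbers of rows of M and M' outside U, and S, S' the sums over P: p
   e <= S + e, p e' = S' + e' and S <= S', so (p-1) e <= (p-1) e'. *)
by nia.
Qed.

Hypothesis M_neq0 : forall i, row i M != 0.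

Lemma supp_le_leq : (n <= n')%N.
Proof.
have := outside_le set0; rewrite /rowspan big_set0.
have -> : outside M (0 : 'M_K) = setT.
  by apply/setP => i; rewrite !inE submx0 M_neq0.
by rewrite cardsT card_ord => /leq_trans; apply; rewrite -[X in (_ <= X)%N]card_ord max_card.
Qed.

End PermutationLemma.

(** By [outside_le], the line of a row of M' contains at least as many rows of M as of M'. Both
    matrices have n rows, so the multisets of lines agree, and matching equal lines gives s. A line
    is encoded by the set of rows of M' in it. *)
Lemma permutation_lemma (F : fieldType) (K n : nat) (M M' : 'M[F]_(n, K)) :
  (forall z : 'cV_K, (#|supp (M' *m z)| + \rank M' <= n.+1)%N ->
     (#|supp (M *m z)| <= #|supp (M' *m z)|)%N) ->
  (forall i, row i M != 0) -> (forall i, row i M' != 0) ->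
  exists s : 'S_n, forall j, exists2 c, c != 0 & row j M' = c *: row (s j) M.
Proof.
move=> supp_le M0 M'0.
pose f j := [set i | (row i M' <= row j M)%MS].
pose f' j := [set i | (row i M' <= row j M')%MS].
have countE (g : 'I_n -> {set 'I_n}) Y :
    count_mem Y [tuple g i | i < n] = #|[set i | g i == Y]|.
  by rewrite count_map cardE -size_filter {1}/enum_mem val_ord_tuple enumT; congr size; apply: eq_filter => i; rewrite !inE.
have : perm_eq [tuple f' i | i < n] [tuple f i | i < n].
  have /count_subseqP[s sub_s perm_s] : forall Y,
      (count_mem Y [tuple f' i | i < n] <= count_mem Y [tuple f i | i < n])%N.
    move=> Y; rewrite !countE; have [->|[j]] := set_0Vmem [set i | f' i == Y].
      by rewrite cards0.
    rewrite inE => /eqP <-.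
    have spanj : (rowspan M' [set j] :=: row j M')%MS.
      by rewrite /rowspan big_set1; apply: genmxE.
    apply: (@leq_trans #|~: outside M' (rowspan M' [set j])|).
      apply/subset_leq_card/subsetP => i; rewrite !inE negbK spanj => /eqP/setP/(_ i).
      by rewrite !inE submx_refl.
    apply: (@leq_trans #|~: outside M (rowspan M' [set j])|).
      rewrite [X in (X <= _)%N]cardsCs [X in (_ <= X)%N]cardsCs !setCK.
      exact: leq_sub2l (outside_le supp_le _).
    apply/subset_leq_card/subsetP => i; rewrite !inE negbK spanj => ij.
    apply/eqP/setP => k; rewrite !inE; apply/idP/idP => /submx_trans; apply => //.
    exact: sub_rV_sym.
  have /eqP <- // : s == [tuple f i | i < n].
  by rewrite -(size_subseq_leqif sub_s) -(perm_size perm_s) !size_tuple.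
case/tuple_permP => s /val_inj eq_f; exists s => j.
have {eq_f} eqj : f' j = f (s j).
  by have := congr1 (fun t : _.-tuple _ => tnth t j) eq_f; rewrite !tnth_mktuple.
have /setP/(_ j) := eqj; rewrite !inE submx_refl => /esym/sub_rVP[c eqc].
by exists c => //; apply: contraNneq (M'0 j) => c0; rewrite eqc c0 scale0r.
Qed.

(** * Comparing two decompositions *)

Section Decompositions.
Variable F : fieldType.

Definition same_tensor I J K R R'
    (A : 'M[F]_(I, R)) (B : 'M[F]_(J, R)) (C : 'M[F]_(K, R))
    (A' : 'M[F]_(I, R')) (B' : 'M[F]_(J, R')) (C' : 'M[F]_(K, R')) : Prop :=
  forall i j k, \sum_r A i r * B j r * C k r = \sum_r A' i r * B' j r * C' k r.

Lemma same_tensor_rot I J K R R'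
    (A : 'M[F]_(I, R)) (B : 'M[F]_(J, R)) (C : 'M[F]_(K, R))
    (A' : 'M[F]_(I, R')) (B' : 'M[F]_(J, R')) (C' : 'M[F]_(K, R')) :
  same_tensor A B C A' B' C' -> same_tensor B C A B' C' A'.
Proof.
move=> eqT j k i; under eq_bigr do rewrite mulrC mulrA.
by rewrite eqT; apply: eq_bigr => r _; rewrite [RHS]mulrC mulrA.
Qed.

Lemma same_tensor_slice I J K R R'
    (A : 'M[F]_(I, R)) (B : 'M[F]_(J, R)) (C : 'M[F]_(K, R))
    (A' : 'M[F]_(I, R')) (B' : 'M[F]_(J, R')) (C' : 'M[F]_(K, R')) :
  same_tensor A B C A' B' C' ->
  forall z : 'cV_I, slice B C (A^T *m z) = slice B' C' (A'^T *m z).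
Proof.
have sliceT n (X : 'M[F]_(I, n)) (Y : 'M_(J, n)) (Z : 'M_(K, n)) (z : 'cV_I) j k :
    slice Y Z (X^T *m z) j k = \sum_i z i 0 * \sum_r X i r * Y j r * Z k r.
  rewrite sliceE; under eq_bigr => r _ do rewrite mxE mulr_sumr mulr_suml.
  rewrite exchange_big; apply: eq_bigr => i _; rewrite mulr_sumr; apply: eq_bigr => r _.
  by rewrite mxE; ring.
by move=> eqT z; apply/matrixP => j k; rewrite !sliceT; under eq_bigr do rewrite eqT.
Qed.

Lemma row_tr_neq0 p n (M : 'M[F]_(p, n)) : nonzero_cols M -> forall i, row i M^T != 0.
Proof. by move=> M0 i; rewrite -tr_col trmx_eq0 M0. Qed.

(** * Consequences of the condition on one mode *)

Section OneMode.
Variables (I J K R : nat) (A : 'M[F]_(I, R)) (B : 'M[F]_(J, R)) (C : 'M[F]_(K, R)).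
Hypothesis srBC : supp_le_rank (R - \rank A + 2) B C.

(** This supplies the hypothesis of Kruskal's lemma. The case of empty support gives rank A <= rank
    A', which with R' <= R brings the support of [A'^T *m z] below the threshold of [srBC]. *)
Lemma same_tensor_supp_le R' (A' : 'M[F]_(I, R')) (B' : 'M[F]_(J, R'))
    (C' : 'M[F]_(K, R')) :
  (R' <= R)%N -> same_tensor A B C A' B' C' ->
  forall z : 'cV_I, (#|supp (A'^T *m z)| + \rank A'^T <= R'.+1)%N ->
    (#|supp (A^T *m z)| <= #|supp (A'^T *m z)|)%N.
Proof.
move=> leR /same_tensor_slice eqT.
have suppA (z : 'cV_I) : (#|supp (A'^T *m z)| < R - \rank A + 2)%N ->
    (#|supp (A^T *m z)| <= #|supp (A'^T *m z)|)%N.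
  by move=> small; apply: srBC small _; rewrite eqT rank_slice.
have rkA : (\rank A^T <= \rank A'^T)%N.
  apply/mxrankS/sub_of_kernel => z A'z.
  have s0 : #|supp (A'^T *m z)| = 0%N.
    by apply/eqP; rewrite cards_eq0; apply/eqP/setP => i; rewrite A'z !inE mxE eqxx.
  have := suppA z; rewrite s0 addn2 => /(_ isT); rewrite leqn0 cards_eq0 => /eqP/setP Az.
  by apply/colP => i; have := Az i; rewrite !inE => /negbFE/eqP ->; rewrite mxE.
move=> z small; apply: suppA; move: rkA (rank_leq_col A) small; rewrite mxrank_tr; lia.
Qed.

Lemma same_tensor_leq R' (A' : 'M[F]_(I, R')) (B' : 'M[F]_(J, R')) (C' : 'M[F]_(K, R')) :
  nonzero_cols A -> same_tensor A B C A' B' C' -> (R <= R')%N.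
Proof.
move=> A0 eqT; have /orP[//|leR] := leq_total R R'.
exact: supp_le_leq (same_tensor_supp_le leR eqT) (row_tr_neq0 A0).
Qed.

Lemma same_tensor_perm (A' : 'M[F]_(I, R)) (B' : 'M[F]_(J, R)) (C' : 'M[F]_(K, R)) :
  nonzero_cols A -> nonzero_cols A' -> same_tensor A B C A' B' C' ->
  exists (s : 'S_R) (a : 'I_R -> F),
    (forall j, a j != 0) /\ (forall i j, A' i j = A i (s j) * a j).
Proof.
move=> A0 A'0 eqT.
have [s sP] := permutation_lemma (same_tensor_supp_le (leqnn R) eqT) (row_tr_neq0 A0)
  (row_tr_neq0 A'0).
have {sP} [a a0 aP] := fin_all_exists2 sP; exists s, a; split=> // i j.
by have /rowP/(_ i) := aP j; rewrite !mxE mulrC.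
Qed.

(** For each r take z with [A^T *m z] nonzero at r and of small support. Contracting the zero slice
    with z gives a relation among few columns of B, with coefficients [y]; these columns are
    independent, so [y = 0] and d vanishes at r. *)
Lemma slice_eq0 : nonzero_cols A -> forall d, slice A B d = 0 -> d = 0.
Proof.
move=> A0 d ABd; apply/colP => r; rewrite [RHS]mxE.
have : ~~ (row r A^T <= rowspan A^T set0)%MS.
  by rewrite /rowspan big_set0 submx0 row_tr_neq0.
case/separating_vector_small_supp => z [_ zr zs].
pose y : 'cV[F]_R := \col_k ((A^T *m z) k 0 * d k 0).
have y0 : y = 0.
  apply: (supp_le_rank_free srBC).
    apply/colP => j; rewrite [RHS]mxE.
    transitivity ((z^T *m slice A B d) 0 j); last by rewrite ABd mulmx0 mxE.
    rewrite /slice mulmxA mulmxA mul_mx_diag !mxE; apply: eq_bigr => k _.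
    rewrite -[z^T *m A]trmxK trmx_mul trmxK !mxE mulrC; congr (_ * _ * _).
  have : (#|supp y| <= #|supp (A^T *m z)|)%N.
    apply/subset_leq_card/subsetP => k; rewrite !inE mxE.
    by apply: contraNneq => ->; rewrite mul0r.
  by move: zs (rank_leq_col A); rewrite mxrank_tr; lia.
have := congr1 (fun w : 'cV_R => w r 0) y0; rewrite !mxE => /eqP.
rewrite mulf_eq0 => /orP[|/eqP //]; move: zr; rewrite -supp_mulmx inE mxE => /negPf-> //.
Qed.

End OneMode.

Lemma supp_le_rank_rowspan p q n m (A : 'M[F]_(p, n)) (B : 'M[F]_(q, n)) (S : {set 'I_n}) i :
  supp_le_rank m A B -> (#|S| < m)%N -> i \notin S -> ~~ (row i A^T <= rowspan A^T S)%MS.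
Proof.
move=> AB Sm iS; apply/negP => /sub_sums_genmxP[u uE].
pose y : 'cV[F]_n := delta_mx i 0 - \sum_(k in S) u k 0 0 *: delta_mx k 0.
have y0 : y = 0.
  apply: (supp_le_rank_free AB).
    apply: trmx_inj; rewrite mulmxBr -colE mulmx_sumr linearB /= tr_col uE trmx0.
    apply/eqP; rewrite subr_eq0; apply/eqP; rewrite raddf_sum; apply: eq_bigr => k _ /=.
    by rewrite -scalemxAr -colE linearZ /= tr_col [u k]mx11_scalar mul_scalar_mx !mxE eqxx mulr1n.
  apply: leq_trans (_ : #|i |: S| <= m)%N; last by rewrite cardsU1 iS.
  apply/subset_leq_card/subsetP => k; rewrite !inE !mxE eqxx andbT => yk.
  apply: contraNT yk; rewrite negb_or => /andP[/negPf-> kS].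
  rewrite summxE big1 ?subr0 // => l lS; rewrite !mxE.
  by have [kl|] := eqVneq k l; rewrite ?mulr0 //; rewrite kl lS in kS.
have := congr1 (fun w : 'cV_n => w i 0) y0; rewrite !mxE !eqxx summxE big1 => [/eqP|k kS].
  by rewrite subr0 oner_eq0.
by rewrite !mxE; have [ik|] := eqVneq i k; rewrite ?mulr0 //; rewrite ik kS in iS.
Qed.

(** * One permutation for two modes, and the third factor *)

Section TwoModes.
Variables (I J K R : nat) (A : 'M[F]_(I, R)) (B : 'M[F]_(J, R)) (C : 'M[F]_(K, R)).
Variables (A' : 'M[F]_(I, R)) (B' : 'M[F]_(J, R)) (C' : 'M[F]_(K, R)).
Hypotheses (srBC : supp_le_rank (R - \rank A + 2) B C)
  (srCA : supp_le_rank (R - \rank B + 2) C A).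
Hypothesis eqT : same_tensor A B C A' B' C'.

Lemma same_perm (s t : 'S_R) (a b : 'I_R -> F) :
  (forall j, a j != 0) -> (forall i j, A' i j = A i (s j) * a j) ->
  (forall j, b j != 0) -> (forall i j, B' i j = B i (t j) * b j) ->
  s = t.
Proof.
move=> a0 A'E b0 B'E; apply/permP => j; apply: contraTeq isT => st.
(* Two distinct columns of A are independent because the threshold in [srCA] is at least 2. *)
have : ~~ (row (s j) A^T <= rowspan A^T [set t j])%MS.
  apply: (supp_le_rank_rowspan (supp_le_rank_sym srCA)); rewrite ?inE //.
  by rewrite cards1 addn2.
case/separating_vector_small_supp => z [/(_ _ (set11 _)) tz sz small].
set S := supp (A^T *m z) in small.
have Sm : (#|S| < R - \rank A + 2)%N.
  by move: small (rank_leq_col A); rewrite mxrank_tr; lia.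
have tS : t j \notin S by rewrite supp_mulmx tz eqxx.
have : ~~ (row (t j) B^T <= rowspan B^T S)%MS by apply: supp_le_rank_rowspan srBC _ _.
apply: contraNN => _; set S' := supp (A'^T *m z).
have S'E k : (k \in S') = (s k \in S).
  rewrite !supp_mulmx; have -> : row k A'^T = a k *: row (s k) A^T.
    by apply/rowP => i; rewrite !mxE A'E mulrC.
  by rewrite -scalemxAl scaler_eq0 (negPf (a0 k)).
have cardS' : #|S'| = #|S|.
  rewrite -(card_imset S' (@perm_inj _ s)); apply: eq_card => k.
  apply/imsetP/idP => [[l lS' ->]|kS]; first by rewrite -S'E.
  by exists (s^-1%g k); rewrite ?S'E permKV.
have jS' : j \in S' by rewrite S'E supp_mulmx.
have subS : (slice C B (A^T *m z) <= rowspan B^T S)%MS.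
  by rewrite /slice -mulmxA (submx_trans (submxMl _ _)) // diag_mx_sub_rowspan.
have subS' : (slice C B (A^T *m z) <= rowspan B'^T S')%MS.
  rewrite -tr_slice (same_tensor_slice eqT) tr_slice /slice -mulmxA.
  by rewrite (submx_trans (submxMl _ _)) // diag_mx_sub_rowspan.
have rkS : (#|S| <= \rank (slice C B (A^T *m z)))%N.
  rewrite -tr_slice mxrank_tr; set k := \rank _.
  have [km|] := ltnP k (R - \rank A + 2); first exact: srBC km _.
  exact/leq_trans/ltnW.
(* The row space of the common slice has dimension at least #|S| = #|S'|, so it fills the span of
   the columns of B' indexed by S'. *)
have S'sub : (rowspan B'^T S' <= rowspan B^T S)%MS.
  apply: submx_trans subS; rewrite -(geq_leqif (mxrank_leqif_sup subS')).
  by rewrite (leq_trans (rank_rowspan _ _)) // cardS'.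
apply: submx_trans S'sub.
have -> : row (t j) B^T = (b j)^-1 *: row j B'^T.
  by apply/rowP => i; rewrite !mxE B'E mulrCA mulVf ?mulr1.
by rewrite scalemx_sub // row_rowspan.
Qed.

Definition perm_scaled : Prop :=
  exists (s : 'S_R) (a b c : 'I_R -> F),
    [/\ forall j, a j * b j * c j = 1, forall i j, A' i j = A i (s j) * a j,
        forall i j, B' i j = B i (s j) * b j & forall i j, C' i j = C i (s j) * c j].

Lemma same_tensor_unique :
  nonzero_cols A -> nonzero_cols B -> nonzero_cols A' -> nonzero_cols B' -> perm_scaled.
Proof.
move=> A0 B0 A'0 B'0.
have [s [a [a0 A'E]]] := same_tensor_perm srBC A0 A'0 eqT.
have [t [b [b0 B'E]]] := same_tensor_perm srCA B0 B'0 (same_tensor_rot eqT).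
have est := same_perm a0 A'E b0 B'E; subst t.
exists s, a, b, (fun j => (a j * b j)^-1); split=> // [j|l j].
  by rewrite divff // mulf_neq0.
(* Row l of C minus row l of the rescaled C', reindexed by the columns of A; equality of the tensors
   makes its slice vanish. *)
pose d : 'cV[F]_R := \col_r (C l r - a (s^-1%g r) * b (s^-1%g r) * C' l (s^-1%g r)).
have /(congr1 (fun w : 'cV_R => w (s j) 0)) : d = 0.
  apply: (slice_eq0 srBC A0); apply/matrixP => i k; rewrite sliceE [RHS]mxE.
  under eq_bigr => r _ do rewrite mxE mulrBr mulrBl mulrAC.
  rewrite sumrB eqT; apply/eqP; rewrite subr_eq0; apply/eqP.
  rewrite [RHS](reindex_inj (@perm_inj _ s)); apply: eq_bigr => r _.
  by rewrite permK A'E B'E; ring.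
rewrite !mxE permK => /eqP; rewrite subr_eq0 => /eqP ->.
by rewrite mulrAC divff ?mul1r // mulf_neq0.
Qed.

End TwoModes.

(** * Symmetry, composition and matrix form of the equivalence *)

Lemma perm_scaled_rot I J K R
    (A A' : 'M[F]_(I, R)) (B B' : 'M[F]_(J, R)) (C C' : 'M[F]_(K, R)) :
  perm_scaled A B C A' B' C' -> perm_scaled B C A B' C' A'.
Proof.
case=> s [a [b [c [abc A'E B'E C'E]]]]; exists s, b, c, a; split=> // j.
by rewrite mulrC mulrA.
Qed.

(** Uniqueness compares two arbitrary decompositions, while the rank conditions concern the given
    one; both are therefore compared with it. *)
Lemma perm_scaled_comp I J K R
    (A A1 A2 : 'M[F]_(I, R)) (B B1 B2 : 'M[F]_(J, R)) (C C1 C2 : 'M[F]_(K, R)) :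
  perm_scaled A B C A1 B1 C1 -> perm_scaled A B C A2 B2 C2 -> perm_scaled A1 B1 C1 A2 B2 C2.
Proof.
case=> s [a [b [c [abc A1E B1E C1E]]]] [t [a' [b' [c' [abc' A2E B2E C2E]]]]].
have abc0 j : [/\ a j != 0, b j != 0 & c j != 0].
  have : a j * b j * c j != 0 by rewrite abc oner_neq0.
  by rewrite !mulf_eq0 !negb_or => /andP[/andP[]].
pose u := (t * s^-1)%g; have uE j : s (u j) = t j by rewrite permM permKV.
exists u, (fun j => a' j / a (u j)), (fun j => b' j / b (u j)), (fun j => c' j / c (u j)).
split=> [j|i j|i j|i j]; have [a0 b0 c0] := abc0 (u j).
- transitivity ((a' j * b' j * c' j) / (a (u j) * b (u j) * c (u j))).
    by field; rewrite a0 b0 c0.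
  by rewrite abc abc' divr1.
- by rewrite A1E A2E uE; field.
- by rewrite B1E B2E uE; field.
- by rewrite C1E C2E uE; field.
Qed.

Lemma perm_scaled_mx I J K R
    (A A' : 'M[F]_(I, R)) (B B' : 'M[F]_(J, R)) (C C' : 'M[F]_(K, R)) :
  perm_scaled A B C A' B' C' ->
  exists P LA LB LC : 'M[F]_R,
    [/\ is_perm_mx P,
        [/\ is_diag_mx LA, is_diag_mx LB & is_diag_mx LC],
        [/\ LA \in unitmx, LB \in unitmx & LC \in unitmx],
        [/\ A' = A *m P *m LA, B' = B *m P *m LB & C' = C *m P *m LC] &
        LA *m LB *m LC = 1%:M].
Proof.
case=> s [a [b [c [abc A'E B'E C'E]]]].
have abc0 j : [/\ a j != 0, b j != 0 & c j != 0].
  have : a j * b j * c j != 0 by rewrite abc oner_neq0.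
  by rewrite !mulf_eq0 !negb_or => /andP[/andP[]].
have unitL (e : 'I_R -> F) : (forall j, e j != 0) -> diag_mx (\row_j e j) \in unitmx.
  by move=> e0; rewrite unitmxE unitfE det_diag; apply/prodf_neq0 => j _; rewrite mxE.
(* The inverse appears because column j of M' comes from column [s j] of M. *)
have mxP p (M M' : 'M[F]_(p, R)) e : (forall i j, M' i j = M i (s j) * e j) ->
    M' = M *m perm_mx s^-1 *m diag_mx (\row_j e j).
  by move=> M'E; rewrite -col_permE mul_mx_diag; apply/matrixP => i j; rewrite !mxE M'E.
exists (perm_mx s^-1), (diag_mx (\row_j a j)), (diag_mx (\row_j b j)), (diag_mx (\row_j c j)).
split; rewrite ?perm_mx_is_perm ?diag_mx_is_diag //.
- by split; apply: unitL => j; case: (abc0 j).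
- by split; apply: mxP.
- rewrite !mulmx_diag -diag_const_mx; congr diag_mx; apply/rowP => j.
  by rewrite !mxE abc.
Qed.

Lemma polyadic_same_tensor I J K R R' (T : tensor F I J K)
    (A : 'M[F]_(I, R)) (B : 'M[F]_(J, R)) (C : 'M[F]_(K, R))
    (A' : 'M[F]_(I, R')) (B' : 'M[F]_(J, R')) (C' : 'M[F]_(K, R')) :
  polyadic T A B C -> polyadic T A' B' C' -> same_tensor A B C A' B' C'.
Proof.
case=> _ _ _ TE [_ _ _ T'E] i j k.
have entry n (X : 'M[F]_(I, n)) (Y : 'M_(J, n)) (Z : 'M_(K, n)) :
    T = \sum_(r < n) outer (col r X) (col r Y) (col r Z) ->
    T (i, j, k) = \sum_r X i r * Y j r * Z k r.
  by move->; rewrite sum_ffunE; apply: eq_bigr => r _; rewrite ffunE /= !mxE.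
by rewrite -(entry _ _ _ _ TE) -(entry _ _ _ _ T'E).
Qed.

End Decompositions.

Theorem corollary1p28 (RR : realType) (F : fieldType)
    (hF : F = (RR : fieldType) \/ F = (complex RR : fieldType))
    (I J K R : nat)
    (A : 'M[F]_(I, R)) (B : 'M[F]_(J, R)) (C : 'M[F]_(K, R))
    (T : tensor F I J K) (hT : polyadic T A B C)
    (mA mB mC : nat)
    (hmA : mA = (R - \rank A + 2)%N)
    (hmB : mB = (R - \rank B + 2)%N)
    (hmC : mC = (R - \rank C + 2)%N)
    (h2 : (compound_kr_full_col_rank mA B C /\ compound_kr_full_col_rank mB C A)
       \/ (compound_kr_full_col_rank mA B C /\ compound_kr_full_col_rank mC A B)
       \/ (compound_kr_full_col_rank mB C A /\ compound_kr_full_col_rank mC A B)) :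
  is_tensor_rank T R /\ cpd_unique T R.
Proof.
subst mA mB mC; have [A0 B0 C0 _] := hT.
have sr := @compound_kr_supp_le_rank F.
split; last first.
  move=> A1 A2 B1 B2 C1 C2 hT1 hT2; apply/perm_scaled_mx.
  suff scaled A' B' C' : polyadic T A' B' C' -> perm_scaled A B C A' B' C'.
    exact: perm_scaled_comp (scaled _ _ _ hT1) (scaled _ _ _ hT2).
  move=> hT'; have [A'0 B'0 C'0 _] := hT'; have eqT := polyadic_same_tensor hT hT'.
  have eqT1 := same_tensor_rot eqT; have eqT2 := same_tensor_rot eqT1.
  (* Cyclic rotation brings each pair of conditions to the first two modes. *)
  case: h2 => [[/sr hA /sr hB]|[[/sr hA /sr hC]|[/sr hB /sr hC]]].
  - exact: same_tensor_unique hA hB eqT A0 B0 A'0 B'0.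
  - exact/perm_scaled_rot/(same_tensor_unique hC hA eqT2 C0 A0 C'0 A'0).
  - exact/perm_scaled_rot/perm_scaled_rot/(same_tensor_unique hB hC eqT1 B0 C0 B'0 C'0).
split=> [|n [A' [B' [C' hT']]]]; first by exists A, B, C.
have eqT := polyadic_same_tensor hT hT'.
case: h2 => [[/sr hA _]|[[/sr hA _]|[/sr hB _]]].
- exact: (same_tensor_leq hA A0 eqT).
- exact: (same_tensor_leq hA A0 eqT).
- exact: (same_tensor_leq hB B0 (same_tensor_rot eqT)).
Qed.
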